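(* For Vertex Cover in the Late Reject model, the competitive ratio is $n-\Theta(1)$, where $n$ is the number of vertices of the input graph, in the following sense. (i) For every online algorithm $\mathrm{ALG}$ in the Late Reject model there is a constant $b>0$ such that the strict competitive ratio of $\mathrm{ALG}$ is at least $n-b$, i.e., for every integer $n\ge 1$, every real $c\ge 0$ with $\mathrm{ALG}(\sigma)\le c\,\mathrm{OPT}(\sigma)$ for all inputs $\sigma$ with $n$ vertices satisfies $c\ge n-b$. (ii) For every constant $b$ there is an online algorithm $\mathrm{ALG}$ in the Late Reject model that is strictly $(n-b)$-competitive for graphs with at least $b+1$ vertices, i.e., $\mathrm{ALG}(\sigma)\le (n-b)\,\mathrm{OPT}(\sigma)$ for every input $\sigma$ with $n\ge b+1$ vertices.
   Context: Online Vertex Cover (vertex arrival). An input $\sigma$ is a finite simple undirected graph $G=(V,E)$ together with an ordering of its vertices. Vertices arrive one by one in this order; when a vertex arrives, all edges between it and previously arrived vertices are revealed. All online algorithms are deterministic: each decision depends only on the part of the input revealed so far (in particular $n=|V|$ is not known in advance). After each arrival has been processed, the set of currently accepted vertices must be a vertex cover of the graph revealed so far (every edge has at least one accepted endpoint). $\mathrm{ALG}(\sigma)$ is the number of accepted vertices at the end of the input, and $\mathrm{OPT}(\sigma)$ is the minimum cardinality of a vertex cover of $G$; the objective is minimization. Late Reject model: upon arrival of a vertex the algorithm either accepts or rejects it; in addition, in any step it may remove (late-reject) any previously accepted vertices. Any rejection (at arrival or late) is irrevocable, i.e., a rejected vertex can never be accepted afterwards. *)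

(* Defs.v *)
From mathcomp Require Import all_boot all_order all_algebra.
From mathcomp Require Import reals.
Set Implicit Arguments.
Unset Strict Implicit.
Unset Printing Implicit Defensive.
Import Order.TTheory GRing.Theory Num.Theory.

(* An input with n vertices: a finite simple graph whose vertices are named by
   their arrival times, so the arrival order is the order of 'I_n. *)
Record sgraph (n : nat) := SGraph {
  edges :> {set {set 'I_n}};
  edges_card2 : [forall e in edges, #|e| == 2]
}.

Definition old_vertex (n : nat) : 'I_n -> 'I_n.+1 := widen_ord (leqnSn n).

Definition prefix_edges (n : nat) (G : sgraph n.+1) : {set {set 'I_n}} :=
  [set e : {set 'I_n} | (@old_vertex n @: e) \in edges G].

Lemma prefix_card2 (n : nat) (G : sgraph n.+1) :
  [forall e in prefix_edges G, #|e| == 2].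
Proof.
apply/forall_inP => e; rewrite inE => /(forall_inP (edges_card2 G)).
by rewrite card_imset // => i j /(congr1 val) /= /val_inj.
Qed.

(* The input as it was before its last vertex arrived. *)
Definition prefix (n : nat) (G : sgraph n.+1) : sgraph n :=
  SGraph (prefix_card2 G).

Definition vertex_cover (n : nat) (G : sgraph n) (C : {set 'I_n}) : bool :=
  [forall e in edges G, C :&: e != set0].

Definition opt (n : nat) (G : sgraph n) : nat :=
  #|[arg min_(C < [set: 'I_n] | vertex_cover G C) #|C|]|.

(* A deterministic strategy in the Late Reject model.  The argument G : sgraph
   n.+1 is everything revealed when the vertex ord_max arrives; earlier
   decisions are functions of its prefixes, so they need not be passed. *)
Record late_reject_strategy := LateRejectStrategy {
  accepts_arrival : forall n : nat, sgraph n.+1 -> bool;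
  late_rejects : forall n : nat, sgraph n.+1 -> {set 'I_n}
}.

(* The vertices currently accepted once all of G has been processed.  Naming a
   vertex that is not accepted in late_rejects has no effect, and no step can
   bring a rejected vertex back. *)
Fixpoint accepted (A : late_reject_strategy) (n : nat) :
    sgraph n -> {set 'I_n} :=
  match n return sgraph n -> {set 'I_n} with
  | 0 => fun _ => set0
  | m.+1 => fun G =>
      let kept :=
        @old_vertex m @: (accepted A (prefix G) :\: late_rejects A G) in
      if accepts_arrival A G then ord_max |: kept else kept
  end.

(* Every stage of an input is itself an input, so quantifying over all inputs
   imposes the cover condition after each arrival. *)
Definition online_algorithm (A : late_reject_strategy) : Prop :=
  forall (n : nat) (G : sgraph n), vertex_cover G (accepted A G).

Definition alg (A : late_reject_strategy) (n : nat) (G : sgraph n) : nat :=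
  #|accepted A G|.

Definition strictly_competitive (R : realType) (A : late_reject_strategy)
    (n : nat) (c : R) : Prop :=
  forall G : sgraph n, ((alg A G)%:R <= c * (opt G)%:R)%R.

(* Main.v *)
Require Import Defs.
From mathcomp Require Import all_boot all_order all_algebra.
From mathcomp Require Import boolp reals.
Import Order.TTheory GRing.Theory Num.Theory.
Local Open Scope ring_scope.

(** (i) On edgeless inputs the algorithm either keeps every vertex, which has
    no finite ratio because OPT = 0, or rejects some vertex v among the first k.
    In the latter case every later vertex is attached to v alone: the optimum
    is 1, but all vertices after the k-th must be accepted.

    (ii) With b a natural number, keep the first b vertices, switch to a minimum
    cover on arrival of vertex b + 1, and from then on accept an arriving vertex
    exactly when the graph has an edge. Each step after that adds at most
    1 <= OPT accepted vertices, and none while OPT = 0. *)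

(** * Optimal covers and accepted sets along prefixes *)

Lemma sgraph_eq {n : nat} (G H : sgraph n) : edges G = edges H -> G = H.
Proof.
case: G H => [E hE] [F hF] /= eEF; rewrite -{}eEF in hF *.
by rewrite (bool_irrelevance hE hF).
Qed.

Lemma old_vertex_inj {n : nat} : injective (@old_vertex n).
Proof. by move=> i j /(congr1 val) /= /val_inj. Qed.

Lemma vertex_coverT {n : nat} (G : sgraph n) : vertex_cover G [set: 'I_n].
Proof.
apply/forall_inP => e /(forall_inP (edges_card2 G)).
by rewrite setTI -card_gt0 => /eqP->.
Qed.

Definition min_cover {n : nat} (G : sgraph n) : {set 'I_n} :=
  [arg min_(C < [set: 'I_n] | vertex_cover G C) #|C|].

Lemma min_cover_cover {n : nat} (G : sgraph n) : vertex_cover G (min_cover G).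
Proof. by rewrite /min_cover; case: arg_minnP => //; apply: vertex_coverT. Qed.

Lemma opt_min {n : nat} (G : sgraph n) (C : {set 'I_n}) :
  vertex_cover G C -> (opt G <= #|C|)%N.
Proof.
rewrite /opt; case: arg_minnP => [|D _ minD]; first exact: vertex_coverT.
exact: minD.
Qed.

Lemma opt_gt0 {n : nat} (G : sgraph n) : (0 < opt G)%N = (edges G != set0).
Proof.
apply/idP/idP => [|/set0Pn[e eG]].
  apply: contraTneq => G0; rewrite -leqNgt -(cards0 'I_n).
  by apply: opt_min; apply/forall_inP => e; rewrite G0 inE.
rewrite lt0n /opt cards_eq0; apply: contraTneq (forall_inP (min_cover_cover G) e eG).
by rewrite /min_cover => ->; rewrite set0I eqxx.
Qed.

Lemma vertex_cover_old {n : nat} (G : sgraph n.+1) (C : {set 'I_n.+1}) :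
  vertex_cover G C -> vertex_cover (Defs.prefix G) (@old_vertex n @^-1: C).
Proof.
move=> covC; apply/forall_inP => e; rewrite inE => /(forall_inP covC).
case/set0Pn => x /setIP[xC /imsetP[y ye ex]]; apply/set0Pn; exists y.
by rewrite !inE ye -ex xC.
Qed.

(** Restricting a minimum cover to the old vertices covers the prefix. This monotonicity carries the
    competitive bound from one arrival to the next. *)
Lemma opt_prefix {n : nat} (G : sgraph n.+1) : (opt (Defs.prefix G) <= opt G)%N.
Proof.
apply: leq_trans (opt_min _ _ (vertex_cover_old _ _ (min_cover_cover G))) _.
by rewrite -(card_imset _ old_vertex_inj) subset_leq_card // sub_imset_pre.
Qed.

Lemma ord_maxVold {n : nat} (i : 'I_n.+1) :
  i = ord_max \/ exists j, i = @old_vertex n j.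
Proof.
case: (ltnP i n) => [lt_in | le_ni]; last first.
  by left; apply/val_inj/eqP; rewrite eqn_leq le_ni -ltnS ltn_ord.
by right; exists (Ordinal lt_in); apply: val_inj.
Qed.

Lemma ord_max_notin_old {n : nat} (C : {set 'I_n}) :
  (ord_max \in @old_vertex n @: C) = false.
Proof.
by apply/negbTE/imsetP=> -[j _ /(congr1 val) /= e]; have := ltn_ord j; rewrite -e ltnn.
Qed.

Lemma accepted_ord_max (A : late_reject_strategy) {n : nat} (G : sgraph n.+1) :
  (ord_max \in accepted A G) = accepts_arrival A G.
Proof. by rewrite /=; case: ifP; rewrite ?setU11 // ord_max_notin_old. Qed.

Lemma accepted_old (A : late_reject_strategy) {n : nat} (G : sgraph n.+1) (i : 'I_n) :
  (old_vertex i \in accepted A G) =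
  (i \in accepted A (Defs.prefix G)) && (i \notin late_rejects A G).
Proof.
have neq_max: (old_vertex i == ord_max :> 'I_n.+1) = false.
  by apply/negbTE; rewrite -val_eqE /= neq_ltn ltn_ord.
rewrite /=; case: ifP => _; rewrite ?in_setU1 ?neq_max /=;
  by rewrite (mem_imset _ _ old_vertex_inj) inE andbC.
Qed.

Lemma vertex_cover_edge {n : nat} (G : sgraph n) (C : {set 'I_n}) (i j : 'I_n) :
  vertex_cover G C -> [set i; j] \in edges G -> (i \in C) || (j \in C).
Proof.
move=> /forall_inP covC /covC /set0Pn[x]; rewrite !inE => /andP[xC].
by case/orP=> /eqP <-; rewrite xC ?orbT.
Qed.

(** * The star adversary for the lower bound *)

Section Adversary.

Variables (v k : nat).

(** The star joining [v] to every other vertex of index at least [k]. Taking [v] and [k] as plain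
    numbers gives one description for all [n], so these graphs are the stages of a single growing
    input. *)
Definition star_edges (n : nat) : {set {set 'I_n}} :=
  [set e : {set 'I_n} | [&& #|e| == 2, [exists i in e, val i == v]
    & [forall i in e, (val i == v) || (k <= val i)%N]]].

Lemma star_card2 (n : nat) : [forall e in star_edges n, #|e| == 2].
Proof. by apply/forall_inP => e; rewrite inE => /and3P[]. Qed.

Definition star (n : nat) : sgraph n := SGraph (star_card2 n).

Lemma prefix_star (n : nat) : Defs.prefix (star n.+1) = star n.
Proof.
apply: sgraph_eq; apply/setP => e; rewrite !inE card_imset; last exact: old_vertex_inj.
congr [&& _, _ & _].
  apply/exists_inP/exists_inP => [[_ /imsetP[i ie ->] iv]|[i ie iv]]; first by exists i.
  by exists (old_vertex i); first exact: imset_f.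
apply/forall_inP/forall_inP => [he i ie | he _ /imsetP[i ie ->]]; last exact: he.
exact: he (imset_f _ ie).
Qed.

Lemma star_small (n : nat) : (n <= k)%N -> edges (star n) = set0.
Proof.
move=> le_nk; apply/setP => e; rewrite !inE; apply/and3P => -[/cards2P[i [j [neq_ij ->]]]].
move=> _ /forall_inP he; case/negP: neq_ij; rewrite -val_eqE.
have /orP[/eqP iv|] := he i (set21 _ _); last by rewrite leqNgt (leq_trans (ltn_ord i)).
have /orP[/eqP jv|] := he j (set22 _ _); last by rewrite leqNgt (leq_trans (ltn_ord j)).
by rewrite iv jv.
Qed.

Lemma star_edge (n : nat) (i j : 'I_n) :
  (v < k)%N -> val i = v -> (k <= val j)%N -> [set i; j] \in edges (star n).
Proof.
move=> lt_vk iv le_kj; rewrite inE cards2 -val_eqE iv neq_ltn (leq_trans lt_vk) //=.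
apply/andP; split; first by apply/exists_inP; exists i; rewrite ?set21 ?iv.
by apply/forall_inP => x /set2P[]->; rewrite ?iv ?eqxx ?le_kj ?orbT.
Qed.

Lemma opt_star (n : nat) : (v < n)%N -> (opt (star n) <= 1)%N.
Proof.
move=> lt_vn; rewrite -(cards1 (Ordinal lt_vn)); apply: opt_min.
apply/forall_inP => e; rewrite inE => /and3P[_ /exists_inP[i ie /eqP iv] _].
by apply/set0Pn; exists i; rewrite !inE ie -val_eqE /= iv eqxx.
Qed.

(** Rejection is irrevocable: the induction starts at stage [k] and passes through the prefixes,
    which are again stars. *)
Lemma star_center_rejected (A : late_reject_strategy) :
  (forall i : 'I_k, val i = v -> i \notin accepted A (star k)) ->
  forall n (i : 'I_n), (v < k <= n)%N -> val i = v -> i \notin accepted A (star n).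
Proof.
move=> rejv; elim=> [|n IHn] i /andP[lt_vk le_kn] iv; first by case: i iv.
move: le_kn; rewrite leq_eqVlt => /predU1P[ek|le_kn].
  by case: _ / ek in i iv *; apply: rejv.
(* The newest vertex has index at least [k], hence it is not the center. *)
case: (ord_maxVold i) => [ei|[j ej]].
  by move: iv le_kn; rewrite ei /= => ->; rewrite ltnS leqNgt lt_vk.
rewrite {}ej in iv *; rewrite accepted_old prefix_star negb_and IHn //.
by rewrite lt_vk.
Qed.

(** With the center rejected, only the other endpoint can cover each of its edges. *)
Lemma alg_star (A : late_reject_strategy) (n : nat) :
  online_algorithm A ->
  (forall i : 'I_k, val i = v -> i \notin accepted A (star k)) ->
  (v < k)%N -> (n - k <= alg A (star n))%N.
Proof.
move=> onA rejv lt_vk; case: (leqP n k) => [/eqP->//|/ltnW le_kn].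
have lt_vn := leq_trans lt_vk le_kn.
have nv : Ordinal lt_vn \notin accepted A (star n).
  by apply: star_center_rejected; rewrite ?lt_vk.
(* [f] enumerates the leaves, that is the indices from [k] to [n - 1]. *)
pose f (j : 'I_(n - k)) : 'I_n := cast_ord (subnKC le_kn) (rshift k j).
have f_inj : injective f by move=> x y /cast_ord_inj /rshift_inj.
rewrite -{1}(card_ord (n - k)) -cardsT -(card_imset _ f_inj).
apply/subset_leq_card/subsetP => _ /imsetP[j _ ->].
have /orP[nv'|//] := vertex_cover_edge _ _ (Ordinal lt_vn) (f j) (onA n (star n))
  (star_edge _ (Ordinal lt_vn) (f j) lt_vk (erefl v) (leq_addr _ _)).
by rewrite nv' in nv.
Qed.

End Adversary.

(** * The algorithm for the upper bound *)

Section WaitThenMinimize.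

Variable b : nat.

(** Here [n] counts the vertices before the arriving one, so [n == b] is the arrival of vertex
    [b + 1]. *)
Definition wait_then_minimize : late_reject_strategy := {|
  accepts_arrival := fun n G =>
    if (n < b)%N then true
    else if n == b then ord_max \in min_cover G
    else edges G != set0;
  late_rejects := fun n G =>
    if n == b then ~: (@old_vertex n @^-1: min_cover G) else set0 |}.

Notation W := wait_then_minimize.

Lemma accepted_early (n : nat) (G : sgraph n) :
  (n <= b)%N -> accepted W G = [set: 'I_n].
Proof.
elim: n G => [|n IHn] G lt_nb; first by apply/setP => -[].
apply/setP => i; rewrite inE; case: (ord_maxVold i) => [->|[j ->]].
  by rewrite accepted_ord_max /= lt_nb.
by rewrite accepted_old IHn 1?ltnW //= ltn_eqF // !inE.
Qed.

(** Nothing has been rejected before the switch, so any set of vertices is still attainable. *)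
Lemma accepted_switch (G : sgraph b.+1) : accepted W G = min_cover G.
Proof.
apply/setP => i; case: (ord_maxVold i) => [->|[j ->]].
  by rewrite accepted_ord_max /= ltnn eqxx.
by rewrite accepted_old accepted_early //= eqxx !inE negbK.
Qed.

Lemma accepted_late (n : nat) (G : sgraph n.+1) : (b < n)%N ->
  accepted W G = if edges G != set0 then ord_max |: @old_vertex n @: accepted W (Defs.prefix G)
                 else @old_vertex n @: accepted W (Defs.prefix G).
Proof. by move=> lt_bn /=; rewrite ltnNge (ltnW lt_bn) gtn_eqF //= setD0. Qed.

Lemma wait_then_minimize_online : online_algorithm W.
Proof.
elim=> [|n IHn] G; first by rewrite accepted_early //; apply: vertex_coverT.
case: (ltngtP n b) => [lt_nb|lt_bn|en]; first by rewrite accepted_early //; apply: vertex_coverT.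
  have [G0|Gn0] := eqVneq (edges G) set0.
    by apply/forall_inP => e; rewrite G0 inE.
  apply/forall_inP => e eG; rewrite accepted_late // Gn0.
  have [mx|mxN] := boolP (ord_max \in e).
    by apply/set0Pn; exists ord_max; rewrite !inE eqxx.
  (* An edge avoiding the new vertex comes from the prefix, whose cover is retained. *)
  have old_e : e = @old_vertex n @: (@old_vertex n @^-1: e).
    apply/setP => x; apply/idP/imsetP => [xe|[y + ->]]; last by rewrite inE.
    case: (ord_maxVold x) => [ex|[y ey]]; first by rewrite ex (negbTE mxN) in xe.
    by exists y; rewrite ?inE -?ey.
  have eP : @old_vertex n @^-1: e \in edges (Defs.prefix G) by rewrite inE -old_e.
  have /set0Pn[y /setIP[yA ye]] := forall_inP (IHn (Defs.prefix G)) _ eP.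
  apply/set0Pn; exists (old_vertex y); rewrite !inE imset_f // orbT /=.
  by move: ye; rewrite inE.
by case: _ / (esym en) in G *; rewrite accepted_switch; apply: min_cover_cover.
Qed.

(** Induction from the switch, where the factor is 1 and the cost is optimal; each later arrival
    pays for itself with one more copy of OPT. *)
Lemma wait_then_minimize_competitive (n : nat) (G : sgraph n) :
  (b < n)%N -> (alg W G <= (n - b) * opt G)%N.
Proof.
elim: n G => [//|n IHn] G; rewrite ltnS leq_eqVlt => /predU1P[en|lt_bn].
  by case: _ / en in G *; rewrite subSnn mul1n /alg accepted_switch.
(* The boolean [0 < opt G] serves as the number of newly accepted vertices. *)
have step : (alg W G <= (0 < opt G) + alg W (Defs.prefix G))%N.
  rewrite /alg accepted_late // opt_gt0; case: ifP => _.
    by rewrite cardsU1 card_imset ?leq_add2r ?leq_b1 //; apply: old_vertex_inj.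
  by rewrite card_imset //; apply: old_vertex_inj.
apply: (leq_trans step); rewrite (subSn (ltnW lt_bn)) mulSn; apply: leq_add.
  by case: (opt G).
by apply: leq_trans (IHn _ lt_bn) _; rewrite leq_mul2l opt_prefix orbT.
Qed.

End WaitThenMinimize.

Theorem theorem13 (R : realType) :
  (forall A : late_reject_strategy, online_algorithm A ->
     exists b : R, 0 < b /\
       forall (n : nat) (c : R), (1 <= n)%N -> 0 <= c ->
         strictly_competitive A n c -> n%:R - b <= c)
  /\
  (forall b : R,
     exists A : late_reject_strategy, online_algorithm A /\
       forall n : nat, b + 1 <= n%:R ->
         strictly_competitive A n (n%:R - b)).
Proof.
split=> [A onA|b].
  have [[n [G [G0 AG]]]|keeps] :=
      EM (exists n (G : sgraph n), edges G = set0 /\ accepted A G != setT).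
    move: AG; rewrite -subTset => /subsetPn[v _ vN].
    have lt_vn := ltn_ord v.
    (* With [k := n] the star has no edges yet, so the bad input [G] is its stage [n]. *)
    have eG : G = star v n n by apply: sgraph_eq; rewrite star_small.
    have rejv (i : 'I_n) : val i = val v -> i \notin accepted A (star v n n).
      by move=> /val_inj->; rewrite -eG.
    (* The constant is the length of the edgeless input on which [A] rejects; for [m <= n] the bound
       is at most 0. *)
    exists n%:R; split=> [|m c _ c0 comp].
      by rewrite ltr0n (leq_trans _ lt_vn).
    have [le_mn|lt_nm] := leqP m n.
      by apply: le_trans c0; rewrite subr_le0 ler_nat.
    rewrite -(natrB _ (ltnW lt_nm)).
    apply: le_trans (_ : (alg A (star v n m))%:R <= _); first by rewrite ler_nat alg_star.
    apply: le_trans (comp _) _; rewrite -[leRHS]mulr1 ler_wpM2l // lern1.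
    by rewrite opt_star // (ltn_trans lt_vn).
  (* Any positive constant would do: on the edgeless graph, written [star 0 n n], the cost is
     [n > 0] while OPT is 0, so no [c] is admissible. *)
  exists 1; split=> // n c n_gt0 _ /(_ (star 0 n n)).
  have E0 := star_small 0 n n (leqnn n).
  have AT : accepted A (star 0 n n) = setT.
    by apply/eqP; apply: contrapT => /negP AN; apply: keeps; exists n, (star 0 n n).
  have := opt_gt0 (star 0 n n); rewrite E0 eqxx lt0n => /negbFE/eqP ->.
  by rewrite /alg AT cardsT card_ord mulr0 lern0 -[n == 0]negbK -lt0n n_gt0.
(* For real [b], the waiting time is the least natural number [k >= b]; minimality turns
   [b + 1 <= n] into [k < n] when [n > 0]. *)
have ex_k : exists k : nat, b <= k%:R by exists (Num.truncn b).+1; rewrite ltW ?truncnS_gt.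
case: (ex_minnP ex_k) => k le_bk min_k.
exists (wait_then_minimize k); split; first exact: wait_then_minimize_online.
(* The empty input can occur when [b] is negative; its cost is 0 and the factor is nonnegative. *)
case=> [|n] le_bn G.
  rewrite /alg [accepted _ _]/= cards0 mulr_ge0 ?ler0n // subr_ge0.
  by apply: le_trans le_bn; rewrite lerDl.
have lt_kn : (k < n.+1)%N by rewrite ltnS min_k // -(lerD2r 1) natr1.
apply: le_trans (_ : ((n.+1 - k) * opt G)%:R <= _).
  by rewrite ler_nat wait_then_minimize_competitive.
by rewrite natrM (natrB _ (ltnW lt_kn)) ler_wpM2r ?ler0n // lerB.
Qed.
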